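(* A curve $C\in|\mathcal{O}(2,2)|$ on $\mathbb{P}^1\times\mathbb{P}^1$ is GIT-stable with respect to the natural $\mathrm{SL}_2\times\mathrm{SL}_2$-action on $\mathbb{P}H^0(\mathbb{P}^1\times\mathbb{P}^1,\mathcal{O}(2,2))$ if and only if $C$ is smooth.
   Context: A biconic curve is a divisor $C\in|\mathcal{O}(2,2)|$ on $\mathbb{P}^1_{[X:U]}\times\mathbb{P}^1_{[Y:V]}$, given by $f=\sum_{0\le i,j\le2}a_{ij}X^iY^jU^{2-i}V^{2-j}$. GIT-stability is with respect to the linearized action of $\mathrm{SL}_2\times\mathrm{SL}_2$. *)

(* Defs.v *)
From HB Require Import structures.
From mathcomp Require Import all_boot all_order all_algebra.
From mathcomp Require Import mpoly.

Set Implicit Arguments.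
Unset Strict Implicit.
Unset Printing Implicit Defensive.

Import Order.TTheory GRing.Theory.
Local Open Scope ring_scope.

Section Biconic.
Variable k : fieldType.

(* Homogeneous coordinates: variable 0 = X, 1 = U (first P^1), 2 = Y, 3 = V
   (second P^1). *)
Definition vX : 'I_4 := @Ordinal 4 0 isT.
Definition vU : 'I_4 := @Ordinal 4 1 isT.
Definition vY : 'I_4 := @Ordinal 4 2 isT.
Definition vV : 'I_4 := @Ordinal 4 3 isT.

Definition biform (a : 'M[k]_3) : {mpoly k[4]} :=
  \sum_(i < 3) \sum_(j < 3)
     a i j *: ('X_vX ^+ i * 'X_vY ^+ j * 'X_vU ^+ (2 - i) * 'X_vV ^+ (2 - j)).

Definition subst_tuple (g h : 'M[k]_2) : 4.-tuple {mpoly k[4]} :=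
  [tuple g 0 0 *: 'X_vX + g 0 1 *: 'X_vU;
         g 1 0 *: 'X_vX + g 1 1 *: 'X_vU;
         h 0 0 *: 'X_vY + h 0 1 *: 'X_vV;
         h 1 0 *: 'X_vY + h 1 1 *: 'X_vV].

Definition act (g h : 'M[k]_2) (f : {mpoly k[4]}) : {mpoly k[4]} :=
  f \mPo subst_tuple g h.

Definition in_orbit (a b : 'M[k]_3) : Prop :=
  exists g h : 'M[k]_2, \det g = 1 /\ \det h = 1 /\ biform b = act g h (biform a).

Definition coordfun (P : {mpoly k[3 * 3]}) (b : 'M[k]_3) : k :=
  P.@[fun i => mxvec b 0 i].

Definition orbit_closed (a : 'M[k]_3) : Prop :=
  forall b : 'M[k]_3,
    (forall P : {mpoly k[3 * 3]},
        (forall b', in_orbit a b' -> coordfun P b' = 0) -> coordfun P b = 0) ->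
    in_orbit a b.

Definition finite_stabilizer (a : 'M[k]_3) : Prop :=
  exists s : seq ('M[k]_2 * 'M[k]_2),
    forall g h : 'M[k]_2, \det g = 1 -> \det h = 1 ->
      act g h (biform a) = biform a -> (g, h) \in s.

(* GIT-stability of the point [f] in P H^0(O(2,2)) (linearization O(1)):
   a lift f != 0 in the affine cone has closed orbit and finite stabilizer. *)
Definition git_stable (a : 'M[k]_3) : Prop :=
  a != 0 /\ orbit_closed a /\ finite_stabilizer a.

Definition pt (x u y v : k) : 'I_4 -> k :=
  fun i => nth 0 [:: x; u; y; v] i.

Definition smooth_curve (a : 'M[k]_3) : Prop :=
  forall x u y v : k, (x, u) != (0, 0) -> (y, v) != (0, 0) ->
    ~ ((biform a).@[pt x u y v] = 0 /\
       forall i : 'I_4, ((biform a)^`M(i)).@[pt x u y v] = 0).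

End Biconic.

(* Main.v *)
(* Writing f = w(x) a w(y)^T with w(x : u) = (u^2, x u, x^2), the group acts by
   a |-> S(g) a S(h)^T, where S maps SL_2 onto the special orthogonal group of
   the discriminant form J = C^T C. Put a' = C a C^T and N = a'^T a'.

   If a is singular at a point, move this point to (0 : 1), (0 : 1), so that
   a_00 = a_10 = a_01 = 0; then diag(t, 1/t), acting on both factors, has a limit
   as t -> 0, and this limit has infinite stabilizer. If the orbit were closed,
   it would contain the limit and a would have infinite stabilizer as well.

   If a is smooth, N has no isotropic eigenvector, because such a vector yields
   a singular point. Hence N is orthogonally diagonalizable with three distinct
   eigenvalues. Its commutant in the orthogonal group consists of sign changes
   of the eigenvectors, so the stabilizer is finite. For b in the orbit closure,
   det (l - N(b)) = 0 for each eigenvalue l of N(a), and det b = det a. Therefore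
   N(b) is orthogonally conjugate to N(a), and two matrices with the same Gram
   matrix, of rank at least 2, and the same determinant differ by a rotation on
   the left. So b is in the orbit of a. *)
Require Import Defs.
From HB Require Import structures.
From mathcomp Require Import all_boot all_order all_algebra.
From mathcomp Require Import fingroup perm ring.
From mathcomp Require Import mpoly.

Set Implicit Arguments.
Unset Strict Implicit.
Unset Printing Implicit Defensive.

Import GRing.Theory.
Local Open Scope ring_scope.

(** * Explicit matrices and small determinants *)

Definition table {T : Type} (d : T) m n (s : seq (seq T)) : 'M[T]_(m, n) :=
  \matrix_(i, j) nth d (nth [::] s i) j.

Ltac ord3 := case=> [[|[|[|//]]]] ?.

(* With entries given by a function on nat, simplification evaluates the
   ordinals produced by expanding sums over 'I_3. *)
Lemma mx_natE (R : pzRingType) m n (A : 'M[R]_(m.+1, n.+1)) :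
  exists F : nat -> nat -> R, A = \matrix_(i, j) F i j.
Proof.
exists (fun i j => A (inord i) (inord j)).
by apply/matrixP => i j; rewrite mxE !inord_val.
Qed.

Lemma col3E (R : pzRingType) (A : 'M[R]_(3, 1)) :
  exists F : nat -> R, A = \matrix_(i, j) F i.
Proof.
exists (fun i => A (inord i) 0).
by apply/matrixP => i j; rewrite mxE !inord_val ord1.
Qed.

Definition mxsimp := (mxE, big_ord_recl, big_ord0).

Lemma det_mx2 (R : comPzRingType) (A : 'M[R]_2) :
  \det A = A 0 0 * A 1 1 - A 0 1 * A 1 0.
Proof.
have [F ->] := mx_natE A.
rewrite (expand_det_row _ 0) !mxsimp /cofactor !det_mx11 !mxE /=; ring.
Qed.

Lemma det3 (R : comPzRingType) (F : nat -> nat -> R) :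
  \det (\matrix_(i < 3, j < 3) F i j) =
  F 0%N 0%N * (F 1%N 1%N * F 2%N 2%N - F 1%N 2%N * F 2%N 1%N)
  - F 0%N 1%N * (F 1%N 0%N * F 2%N 2%N - F 1%N 2%N * F 2%N 0%N)
  + F 0%N 2%N * (F 1%N 0%N * F 2%N 1%N - F 1%N 1%N * F 2%N 0%N).
Proof.
rewrite (expand_det_row _ 0) !mxsimp /cofactor !det_mx2 !mxE /=; ring.
Qed.

Lemma det_table (R : comPzRingType) (s : seq (seq R)) (F := fun i j => nth 0 (nth [::] s i) j) :
  \det (table 0 3 3 s) =
  F 0%N 0%N * (F 1%N 1%N * F 2%N 2%N - F 1%N 2%N * F 2%N 1%N)
  - F 0%N 1%N * (F 1%N 0%N * F 2%N 2%N - F 1%N 2%N * F 2%N 0%N)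
  + F 0%N 2%N * (F 1%N 0%N * F 2%N 1%N - F 1%N 1%N * F 2%N 0%N).
Proof. exact: (det3 F). Qed.

(** * The symmetric square of a 2 x 2 matrix and the discriminant form *)

Section Sym2.
Variable R : comPzRingType.
Implicit Types (g h : 'M[R]_2) (x u y v : R).

(* The matrix of q |-> q \o g on binary quadratic forms, in the basis
   U^2, X U, X^2: column [i] lists the coefficients of
   (g00 X + g01 U)^i (g10 X + g11 U)^(2 - i). *)
Definition sym2 g : 'M[R]_3 := table 0 3 3
  [:: [:: g 1 1 ^+ 2; g 0 1 * g 1 1; g 0 1 ^+ 2];
      [:: 2%:R * g 1 0 * g 1 1; g 0 0 * g 1 1 + g 0 1 * g 1 0; 2%:R * g 0 0 * g 0 1];
      [:: g 1 0 ^+ 2; g 0 0 * g 1 0; g 0 0 ^+ 2]].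

Definition veronese x u : 'rV[R]_3 := table 0 1 3 [:: [:: u ^+ 2; x * u; x ^+ 2]].
Definition veroneseX x u : 'rV[R]_3 := table 0 1 3 [:: [:: 0; u; 2%:R * x]].
Definition veroneseU x u : 'rV[R]_3 := table 0 1 3 [:: [:: 2%:R * u; x; 0]].

(* Gram matrix of the discriminant c1^2 - 4 c0 c2. *)
Definition discmx : 'M[R]_3 := table 0 3 3
  [:: [:: 0; 0; - 2%:R]; [:: 0; 1; 0]; [:: - 2%:R; 0; 0]].

Definition mx2 x u y v : 'M[R]_2 := table 0 2 2 [:: [:: x; u]; [:: y; v]].

Lemma mx2_eta g : g = mx2 (g 0 0) (g 0 1) (g 1 0) (g 1 1).
Proof.
have [F ->] := mx_natE g.
by apply/matrixP => [] [[|[|//]] ?] [[|[|//]] ?]; rewrite !mxE.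
Qed.

Lemma det_mx2_of x u y v : \det (mx2 x u y v) = x * v - u * y.
Proof. by rewrite det_mx2 !mxE. Qed.

(** The order is reversed because [sym2 g] acts by precomposition with [g]. *)
Lemma sym2M g h : sym2 g *m sym2 h = sym2 (h *m g).
Proof.
have [F ->] := mx_natE g; have [G ->] := mx_natE h.
apply/matrixP; ord3; ord3; rewrite !mxsimp /=; ring.
Qed.

Lemma sym2_1 : sym2 1%:M = 1%:M.
Proof. by apply/matrixP; ord3; ord3; rewrite !mxsimp /=; ring. Qed.

(** The discriminant of q \o g is that of q times the squared determinant; this is the polarized
    form. *)
Lemma sym2_disc g : (sym2 g)^T *m discmx *m sym2 g = \det g ^+ 2 *: discmx.
Proof.
have [F ->] := mx_natE g; rewrite det_mx2.
apply/matrixP; ord3; ord3; rewrite !mxsimp /=; ring.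
Qed.

Lemma det_sym2 g : \det (sym2 g) = \det g ^+ 3.
Proof.
have [F ->] := mx_natE g; rewrite det_mx2.
rewrite det_table !mxE /=; ring.
Qed.

Lemma veronese_sym2 g x u :
  veronese x u *m sym2 g = veronese (g 0 0 * x + g 0 1 * u) (g 1 0 * x + g 1 1 * u).
Proof.
apply/matrixP => i; rewrite ord1 {i}; ord3; rewrite !mxsimp /=; ring.
Qed.
End Sym2.

(** * Biquadratic forms as bilinear expressions in Veronese vectors *)

Lemma bilin_sandwich (R : comPzRingType) m n p q r s (x : 'M[R]_(m, n)) (S : 'M_(n, p))
    (a : 'M_(p, q)) (T : 'M_(r, q)) (y : 'M_(s, r)) :
  x *m S *m a *m (y *m T)^T = x *m (S *m a *m T^T) *m y^T.
Proof. by rewrite trmx_mul !mulmxA. Qed.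

(** Kept over any commutative ring: at the four indeterminates it is the form itself, at scalars its
    value. *)
Definition fval (R : comPzRingType) (a : 'M[R]_3) (x u y v : R) :=
  (veronese x u *m a *m (veronese y v)^T) 0 0.

Lemma fvalE (R : comPzRingType) (F : nat -> nat -> R) x u y v :
  fval (\matrix_(i, j) F i j) x u y v =
  u ^+ 2 * (F 0%N 0%N * v ^+ 2 + F 0%N 1%N * (y * v) + F 0%N 2%N * y ^+ 2)
  + x * u * (F 1%N 0%N * v ^+ 2 + F 1%N 1%N * (y * v) + F 1%N 2%N * y ^+ 2)
  + x ^+ 2 * (F 2%N 0%N * v ^+ 2 + F 2%N 1%N * (y * v) + F 2%N 2%N * y ^+ 2).
Proof. rewrite /fval !mxsimp /=; ring. Qed.

Section Bilin.
Variable R : comPzRingType.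

Lemma map_veronese (S : comPzRingType) (f : {rmorphism R -> S}) (x u : R) :
  map_mx f (veronese x u) = veronese (f x) (f u).
Proof. by apply/matrixP => i; rewrite ord1 {i}; ord3; rewrite !mxE /= ?rmorphM ?rmorphXn. Qed.

Lemma map_veroneseXU (S : comPzRingType) (f : {rmorphism R -> S}) (c d x u : R) :
  map_mx f (c *: veroneseX x u + d *: veroneseU x u) =
  f c *: veroneseX (f x) (f u) + f d *: veroneseU (f x) (f u).
Proof.
by apply/matrixP => i; rewrite ord1 {i}; ord3;
  rewrite !mxE /= !(rmorphD, rmorphM, rmorph_nat, rmorph0).
Qed.

Lemma map_sym2 (S : comPzRingType) (f : {rmorphism R -> S}) (g : 'M[R]_2) :
  map_mx f (sym2 g) = sym2 (map_mx f g).
Proof.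
by apply/matrixP; ord3; ord3; rewrite !mxE /= ?rmorphD ?rmorphM ?rmorphXn ?rmorph_nat.
Qed.

Lemma map_bilin (S : comPzRingType) (f : {rmorphism R -> S}) a (x u y v : R) :
  f (fval a x u y v) = fval (map_mx f a) (f x) (f u) (f y) (f v).
Proof. by rewrite /fval -!map_veronese map_trmx -!map_mxM [RHS]mxE. Qed.

Lemma veronese_subst (S : comPzRingType) (f : {rmorphism R -> S}) (g h : 'M[R]_2) a (x u y v : S) :
  fval (map_mx f a) (f (g 0 0) * x + f (g 0 1) * u) (f (g 1 0) * x + f (g 1 1) * u)
     (f (h 0 0) * y + f (h 0 1) * v) (f (h 1 0) * y + f (h 1 1) * v)
  = fval (map_mx f (sym2 g *m a *m (sym2 h)^T)) x u y v.
Proof.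
rewrite /fval !map_mxM -map_trmx !map_sym2 -bilin_sandwich !veronese_sym2.
by rewrite ![map_mx f _ _ _]mxE.
Qed.

(** The Veronese row has derivative [D x *: veroneseX x u + D u *: veroneseU x u], so this is the
    product rule. With an abstract [D], [ring] concludes after expansion. *)
Lemma derivation_bilin (D : R -> R) (a : 'M[R]_3) (x u y v : R) :
  {morph D : p q / p + q} -> (forall p q, D (p * q) = D p * q + p * D q) ->
  (forall i j, D (a i j) = 0) ->
  D (fval a x u y v) =
   ((D x *: veroneseX x u + D u *: veroneseU x u) *m a *m (veronese y v)^T) 0 0 +
   (veronese x u *m a *m (D y *: veroneseX y v + D v *: veroneseU y v)^T) 0 0.
Proof.
move=> DD DM Da.
have D0 : D 0 = 0 by apply: (@addrI _ (D 0)); rewrite -DD !addr0.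
have {}Da : forall i j : nat, D (a (inord i) (inord j)) = 0 by [].
have E : a = \matrix_(i, j) a (inord i) (inord j).
  by apply/matrixP => i j; rewrite mxE !inord_val.
rewrite {}E; move: (fun i j : nat => a (inord i) (inord j)) Da => F DF.
rewrite /fval !mxsimp /= !expr2.
rewrite !(DD, DM, D0) !{}DF.
ring.
Qed.
End Bilin.

(** * Group action, coefficients and singular points in matrix terms *)

Section Biform.
Variable k : fieldType.
Implicit Types (a b : 'M[k]_3) (g h : 'M[k]_2) (x u y v : k).

Local Notation mpC := (map_mx (@mpolyC 4 k)).

Lemma biformE a :
  biform a = fval (mpC a) 'X_vX 'X_vU 'X_vY 'X_vV.
Proof.
have [F ->] := mx_natE a.
rewrite /fval /biform !mxsimp /=.
rewrite -!mul_mpolyC /=. ring.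
Qed.

Lemma act_biform g h a : act g h (biform a) = biform (sym2 g *m a *m (sym2 h)^T).
Proof.
rewrite !biformE -veronese_subst /act (map_bilin (comp_mpoly (subst_tuple g h))) /=.
rewrite !comp_mpolyXU /= -!mul_mpolyC.
have -> // : map_mx (comp_mpoly (subst_tuple g h)) (mpC a) = mpC a.
by apply/matrixP => i j; rewrite 2!mxE comp_mpolyC.
Qed.

Lemma meval_biform a x u y v : (biform a).@[pt x u y v] = fval a x u y v.
Proof.
rewrite biformE (map_bilin (meval (pt x u y v))) /= !mevalXU.
have -> // : map_mx (meval (pt x u y v)) (mpC a) = a.
by apply/matrixP => i j; rewrite 2!mxE mevalC.
Qed.

Lemma mderiv_biform (i : 'I_4) a (x u y v : {mpoly k[4]}) :
  (fval (mpC a) x u y v)^`M(i) =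
   ((x^`M(i) *: veroneseX x u + u^`M(i) *: veroneseU x u) *m mpC a *m (veronese y v)^T) 0 0 +
   (veronese x u *m mpC a *m (y^`M(i) *: veroneseX y v + v^`M(i) *: veroneseU y v)^T) 0 0.
Proof.
apply: derivation_bilin; [exact: mderivD|exact: mderivM|].
by move=> p q; rewrite mxE mderivC.
Qed.

(** A binary quadratic form is determined by its values at (0 : 1), (1 : 0) and (1 : 1), so nine
    points determine the coefficients. *)
Lemma biform_inj : injective (@biform k).
Proof.
move=> a b ab; apply/eqP; rewrite -subr_eq0; apply/eqP.
have : forall x u y v, fval (a - b) x u y v = 0.
  move=> x u y v; rewrite /fval mulmxBr mulmxBl [LHS]mxE [X in _ + X]mxE.
  by rewrite -/(fval a x u y v) -/(fval b x u y v) -!meval_biform ab subrr.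
have [F ->] := mx_natE (a - b).
move=> H.
have := (H 0 1 0 1, H 0 1 1 0, H 1 0 0 1, H 1 0 1 0, H 0 1 1 1, H 1 0 1 1, H 1 1 0 1, H 1 1 1 0, H 1 1 1 1).
rewrite !fvalE.
rewrite !(expr0n, expr1n, mul0r, mulr0, mul1r, mulr1, addr0, add0r) /=.
do 8![case]; move=> F00 F02 F20 F22.
rewrite !(F00, F02, F20, F22, addr0, add0r) => F01 F21 F10 F12.
rewrite !(F01, F21, F10, F12, addr0, add0r) => F11.
by apply/matrixP; ord3; ord3; rewrite !mxE.
Qed.

Lemma mderivXU (i j : 'I_4) : ('X_i : {mpoly k[4]})^`M(j) = (i == j)%:R.
Proof.
rewrite mderivX mnm1E; case: eqP => [->|_]; last by rewrite scale0r.
rewrite scale1r -mpolyX0; congr 'X_[_].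
by apply/mnmP => l; rewrite mnmBE mnm0E subnn.
Qed.

Definition singular_at a x u y v :=
  [/\ fval a x u y v = 0,
      veroneseX x u *m a *m (veronese y v)^T = 0,
      veroneseU x u *m a *m (veronese y v)^T = 0,
      veronese x u *m a *m (veroneseX y v)^T = 0 &
      veronese x u *m a *m (veroneseU y v)^T = 0].

Lemma singular_atP a x u y v :
  (biform a).@[pt x u y v] = 0 /\ (forall i, ((biform a)^`M(i)).@[pt x u y v] = 0)
  <-> singular_at a x u y v.
Proof.
rewrite meval_biform biformE.
have ev (p q : 'rV[{mpoly k[4]}]_3) : meval (pt x u y v) ((p *m mpC a *m q^T) 0 0) =
    (map_mx (meval (pt x u y v)) p *m a *m (map_mx (meval (pt x u y v)) q)^T) 0 0.
  have {2}-> : a = map_mx (meval (pt x u y v)) (mpC a).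
    by apply/matrixP => i j; rewrite 2!mxE mevalC.
  by rewrite map_trmx -!map_mxM [RHS]mxE.
have mx11 (A : 'M[k]_1) : A 0 0 = 0 <-> A = 0.
  split=> [A0|->]; last by rewrite mxE.
  by apply/matrixP => i j; rewrite !ord1 A0 mxE.
have E i : (fval (mpC a) 'X_vX 'X_vU 'X_vY 'X_vV)^`M(i).@[pt x u y v] =
  ((((vX == i)%:R *: veroneseX x u + (vU == i)%:R *: veroneseU x u) *m a *m (veronese y v)^T) 0 0
  + (veronese x u *m a *m ((vY == i)%:R *: veroneseX y v + (vV == i)%:R *: veroneseU y v)^T) 0 0).
  rewrite mderiv_biform mevalD !ev !(map_veroneseXU (meval (pt x u y v))) !mderivXU.
  by rewrite !map_veronese /= !mevalXU !rmorph_nat.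
split=> [[f0 df]|[f0 fX fU fY fV]]; split=> //.
- by apply/mx11; have := df vX; rewrite E /= !scale0r !scale1r !addr0 trmx0 mulmx0 [X in _ + X]mxE addr0.
- by apply/mx11; have := df vU; rewrite E /= !scale0r !scale1r !(addr0, add0r) trmx0 mulmx0 [X in _ + X]mxE addr0.
- by apply/mx11; have := df vY; rewrite E /= !scale0r !scale1r !(addr0, add0r) !mul0mx [X in X + _]mxE add0r.
- by apply/mx11; have := df vV; rewrite E /= !scale0r !scale1r !(addr0, add0r) !mul0mx [X in X + _]mxE add0r.
move=> i; rewrite E linearD !linearZ /= !(mulmxDl, mulmxDr) -!scalemxAl -!scalemxAr fX fU fY fV.
by rewrite !scaler0 addr0 mxE addr0.
Qed.

Lemma in_orbitP a b : Defs.in_orbit a b <->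
  exists g h, [/\ \det g = 1, \det h = 1 & b = sym2 g *m a *m (sym2 h)^T].
Proof.
split=> [[g [h [dg [dh]]]]|[g [h [dg dh ->]]]].
  by rewrite act_biform => /biform_inj ->; exists g, h.
by exists g, h; do 2![split=> //]; rewrite act_biform.
Qed.
End Biform.

(** * Orthogonal diagonalization over an algebraically closed field *)

Section Orth.
Variable k : closedFieldType.
Hypothesis two_neq0 : 2%:R != 0 :> k.

Lemma closed_sqrt (c : k) : exists r, r ^+ 2 = c.
Proof.
have [r rE] := @GRing.solve_monicpoly k 2%N (fun i => if i == 0%N then c else 0) isT.
by exists r; apply: etrans rE _; rewrite !big_ord_recl big_ord0 /= mulr1 mul0r !addr0.
Qed.

Lemma binary_quadratic_root (c0 c1 c2 : k) :
  exists x u, (x, u) != (0, 0) /\ c0 * u ^+ 2 + c1 * (x * u) + c2 * x ^+ 2 = 0.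
Proof.
have [->|c2N0] := eqVneq c2 0.
  by exists 1, 0; split; [rewrite xpair_eqE oner_eq0 | ring].
have [r r2] := closed_sqrt (c1 ^+ 2 - 4%:R * c0 * c2).
exists ((r - c1) / (2%:R * c2)), 1; split; first by rewrite xpair_eqE oner_eq0 andbF.
transitivity ((r ^+ 2 - (c1 ^+ 2 - 4%:R * c0 * c2)) / (4%:R * c2)); last by rewrite r2 subrr mul0r.
by field; rewrite c2N0 two_neq0 /= (natrM _ 2 2) mulf_neq0.
Qed.

(** Isotropic eigenvectors are the obstruction to diagonalizing a symmetric matrix orthogonally,
    since they cannot be normalized. *)
Definition no_null_eigenvector n (N : 'M[k]_n) :=
  forall (z : 'rV_n) (l : k), z *m N = l *: z -> z *m z^T = 0 -> z = 0.

(** Householder reflection in v - s e, where e is the first basis vector. The sign s is left free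
    because v - e may be isotropic. *)
Lemma unit_reflection n (v : 'rV[k]_(1 + n)) : v *m v^T = 1%:M ->
  exists (H : 'M_(1 + n)) (s : k),
    [/\ H^T = H, H *m H = 1%:M, s ^+ 2 = 1 & v *m H = s *: row_mx 1%:M 0].
Proof.
move=> v1; set e := row_mx 1%:M 0 : 'rV[k]_(1 + n).
have ee : e *m e^T = 1%:M by rewrite tr_row_mx mul_row_col trmx1 mulmx1 mul0mx addr0.
pose t := (v *m e^T) 0 0.
have ve : v *m e^T = t%:M by rewrite [LHS]mx11_scalar.
have ev : e *m v^T = t%:M by rewrite -[LHS]trmxK trmx_mul trmxK ve tr_scalar_mx.
(* The squared length of v - s e is 2 (1 - s t). If t = 1, the choice s = -1 makes it 4. *)
have [s s2 ts] : exists2 s : k, s ^+ 2 = 1 & 1 - s * t != 0.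
  have [t1|tN1] := eqVneq t 1; last by exists 1; rewrite ?expr1n ?mul1r // subr_eq0 eq_sym.
  by exists (-1); rewrite ?sqrrN ?expr1n // t1 mulr1 opprK.
have [d dE] : exists d, d = v - s *: e by exists (v - s *: e).
have dT : d^T = v^T - s *: e^T by rewrite dE linearB linearZ.
have dd : d *m d^T = (2%:R * (1 - s * t))%:M.
  rewrite dT dE mulmxBl !mulmxBr -!scalemxAl -!scalemxAr ve ev ee v1.
  apply/matrixP => i j; rewrite !ord1 !mxE /= !mulr1n.
  by transitivity (1 - s * t - (s * t - s ^+ 2)); [ring | rewrite s2; ring].
have vd : v *m d^T = (1 - s * t)%:M.
  rewrite dT mulmxBr -!scalemxAr ve v1.
  by apply/matrixP => i j; rewrite !ord1 !mxE /= !mulr1n.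
pose H := 1%:M - (1 - s * t)^-1 *: (d^T *m d).
have HT : H^T = H by rewrite /H linearB /= linearZ /= trmx_mul trmxK trmx1.
have HH : H *m H = 1%:M.
  have PP : d^T *m d *m (d^T *m d) = (2%:R * (1 - s * t)) *: (d^T *m d).
    by rewrite -mulmxA (mulmxA d) dd mul_scalar_mx -scalemxAr.
  rewrite /H; move: (d^T *m d) PP => P PP.
  rewrite mulmxBl !mulmxBr !mul1mx mulmx1 -!scalemxAl -!scalemxAr PP.
  by apply/matrixP => i j; rewrite !mxE; field.
exists H, s; split=> //.
rewrite /H mulmxBr mulmx1 -scalemxAr mulmxA vd mul_scalar_mx scalerA mulVf // scale1r dE.
by rewrite opprB addrC subrK.
Qed.

(** Induction on the size: normalize an eigenvector and reflect it to the first basis vector. By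
    symmetry the matrix splits into blocks, and a null eigenvector of the smaller block would give
    one of [N]. *)
Lemma orthogonal_diagonalization n (N : 'M[k]_n) :
  N^T = N -> no_null_eigenvector N ->
  exists (V : 'M_n) (d : 'rV_n), V *m V^T = 1%:M /\ V *m N *m V^T = diag_mx d.
Proof.
elim: n N => [|n IH] N NT Nnull.
  by exists 1%:M, 0; split; apply/matrixP; case.
rewrite -[n.+1]/(1 + n)%N in N NT Nnull *.
have [l] : exists l, root (char_poly N) l by apply/closed_rootP; rewrite size_char_poly.
rewrite -eigenvalue_root_char => /eigenvalueP [w wN w0].
have [r r2] := closed_sqrt ((w *m w^T) 0 0).
have r0 : r != 0.
  apply: contra w0 => /eqP r0; apply/eqP; apply: Nnull wN _.
  by apply/matrixP => i j; rewrite !ord1 -r2 r0 expr0n mxE.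
have [v v1 vN] : exists2 v : 'rV_(1 + n), v *m v^T = 1%:M & v *m N = l *: v.
  exists (r^-1 *: w); last by rewrite -scalemxAl wN !scalerA mulrC.
  rewrite linearZ /= -scalemxAl -scalemxAr scalerA.
  apply/matrixP => i j; rewrite !ord1 [LHS]mxE -r2 !mxE /= mulr1n.
  by field.
have [H [s [HT HH s2 vH]]] := unit_reflection v1.
pose e : 'rV[k]_(1 + n) := row_mx 1%:M 0.
have eH : e *m H = s *: v.
  have -> : e = s *: (v *m H) by rewrite vH scalerA -expr2 s2 scale1r.
  by rewrite -scalemxAl -mulmxA HH mulmx1.
have [M ME] : exists M, M = H *m N *m H by exists (H *m N *m H).
have HN : H *m N = M *m H by rewrite ME -mulmxA HH mulmx1.
have MT : M^T = M by rewrite ME !trmx_mul HT NT mulmxA.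
have eM : e *m M = l *: e.
  rewrite ME !mulmxA eH -!scalemxAl vN -scalemxAl vH !scalerA -mulrA mulrCA.
  by rewrite -expr2 s2 mulr1.
have [ul ur] : ulsubmx M = l%:M /\ ursubmx M = 0.
  move: eM; rewrite /e -{1}[M]submxK mul_row_block !mul1mx !mul0mx !addr0 scale_row_mx scaler0.
  by move=> /eq_row_mx [-> ->]; rewrite scale_scalar_mx mulr1.
have dl : dlsubmx M = 0 by rewrite -MT -trmx_ursub ur trmx0.
have Mblock : M = block_mx l%:M 0 0 (drsubmx M) by rewrite -{1}[M]submxK ul ur dl.
have [||V [d [VV VNV]]] := IH (drsubmx M).
- by rewrite trmx_drsub MT.
- move=> z m zM zz.
  suff : row_mx 0 z *m H = 0 :> 'rV_(1 + n).
    move/(congr1 (mulmx^~ H)); rewrite -mulmxA HH mulmx1 mul0mx => /rowP z0.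
    by apply/rowP => j; have := z0 (rshift 1 j); rewrite row_mxEr !mxE.
  apply: (Nnull _ m).
    rewrite -mulmxA HN mulmxA Mblock mul_row_block !mul0mx !mulmx0 addr0 add0r zM.
    by rewrite scalemxAl scale_row_mx scaler0.
  by rewrite trmx_mul HT -mulmxA (mulmxA H) HH mul1mx tr_row_mx mul_row_col trmx0 mulmx0 add0r.
pose W : 'M[k]_(1 + n) := block_mx 1%:M 0 0 V.
exists (W *m H), (row_mx l%:M d); split.
  rewrite trmx_mul HT -mulmxA (mulmxA H) HH mul1mx /W tr_block_mx mulmx_block.
  by rewrite !trmx0 !trmx1 !mulmx0 !mul0mx !mulmx1 VV !addr0 add0r -scalar_mx_block.
rewrite trmx_mul HT -(mulmxA W H) HN !mulmxA -(mulmxA _ H H) HH mulmx1 Mblock.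
rewrite /W tr_block_mx !mulmx_block !trmx0 !trmx1 !mulmx0 !mul0mx !mulmx1 !mul1mx !addr0 !add0r.
rewrite VNV diag_mx_row; congr (block_mx _ _ _ _); last exact: mul0mx.
by apply/matrixP => i j; rewrite !ord1 !mxE /= !mulr1n.
Qed.

(** If two orthonormal eigenvectors v, w shared an eigenvalue, v + I w with I^2 = -1 would be an
    isotropic eigenvector. *)
Lemma distinct_eigenvalues n (N V : 'M[k]_n) (d : 'rV_n) :
  no_null_eigenvector N -> V *m V^T = 1%:M -> V *m N *m V^T = diag_mx d ->
  injective (d 0).
Proof.
move=> Nnull VV VNV i j dij; apply/eqP/negPn/negP => ij.
have [I I2] := closed_sqrt (-1).
have VN : V *m N = diag_mx d *m V by rewrite -VNV -[RHS]mulmxA (mulmx1C VV) mulmx1.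
pose z : 'rV_n := delta_mx 0 i + I *: delta_mx 0 j.
have zd : z *m diag_mx d = d 0 i *: z.
  by rewrite /z mulmxDl -scalemxAl -!rowE !row_diag_mx scalerDr -dij !scalerA mulrC.
have zV0 : z *m V = 0.
  apply: (Nnull _ (d 0 i)).
    by rewrite -mulmxA VN mulmxA zd -scalemxAl.
  rewrite trmx_mul -mulmxA (mulmxA V) VV mul1mx /z linearD /= linearZ /= !trmx_delta.
  rewrite mulmxDl !mulmxDr -!scalemxAl -!scalemxAr !mul_delta_mx_cond !eqxx (negPf ij) eq_sym (negPf ij).
  by rewrite !mulr1n !mulr0n !scaler0 add0r addr0 scalerA -expr2 I2 scaleN1r subrr.
have : z *m V *m V^T = 0 by rewrite zV0 mul0mx.
rewrite -mulmxA VV mulmx1 => /matrixP/(_ 0 i).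
by rewrite !mxE !eqxx (negPf ij) /= mulr0 addr0 => /eqP; rewrite oner_eq0.
Qed.

Lemma eigenvalue_diag n (N V : 'M[k]_n) (d : 'rV_n) i :
  V *m V^T = 1%:M -> V *m N *m V^T = diag_mx d -> \det ((d 0 i)%:M - N) = 0.
Proof.
move=> VV VNV.
have VN : V *m N = diag_mx d *m V by rewrite -VNV -[RHS]mulmxA (mulmx1C VV) mulmx1.
apply/eqP/det0P; exists (row i V); last first.
  rewrite mulmxBr mul_mx_scalar -row_mul VN; apply/rowP => j.
  by rewrite mul_diag_mx !mxE subrr.
apply/eqP => V0.
have : row i (V *m V^T) = 0 by rewrite row_mul V0 mul0mx.
by rewrite VV => /rowP/(_ i)/eqP; rewrite !mxE eqxx oner_eq0.
Qed.

(** Eigenvectors for distinct eigenvalues are independent and, [N] being symmetric, orthogonal;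
    their Gram matrix is diagonal and invertible, and square roots normalize them. This serves for
    points of the orbit closure, where only the determinants are known to vanish. *)
Lemma orthonormal_eigenbasis n (N : 'M[k]_n) (d : 'rV_n) :
  N^T = N -> injective (d 0) -> (forall i, \det ((d 0 i)%:M - N) = 0) ->
  exists V, V *m V^T = 1%:M /\ V *m N *m V^T = diag_mx d.
Proof.
move=> NT dinj detd.
have /fin_all_exists [v vP] i : exists v : 'rV_n, v != 0 /\ v *m N = d 0 i *: v.
  have /eqP/det0P [v v0 vN] := detd i; exists v; split=> //; apply/eqP.
  by rewrite eq_sym -subr_eq0 -mul_mx_scalar -mulmxBr vN.
pose B := \matrix_i v i.
have BN : B *m N = diag_mx d *m B.
  apply/row_matrixP => i; rewrite row_mul rowK (vP i).2.
  by apply/rowP => j; rewrite mul_diag_mx !mxE.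
have Bunit : B \in unitmx.
  rewrite unitmxE unitfE; apply/negP => /det0P [u u0 uB].
  (* Applying N - c to a linear relation multiplies its j-th coefficient by d_j - c. Running c over
     all eigenvalues but d_i isolates the i-th coefficient. *)
  have key (s : seq k) : (\row_j (u 0 j * \prod_(c <- s) (d 0 j - c))) *m B = 0.
    elim: s => [|c s IHs].
      by rewrite -[RHS]uB; congr (_ *m _); apply/rowP => j; rewrite mxE big_nil mulr1.
    transitivity ((\row_j (u 0 j * \prod_(c <- s) (d 0 j - c))) *m (diag_mx d - c%:M) *m B).
      congr (_ *m _); apply/rowP => j.
      by rewrite mulmxBr mul_mx_diag mul_mx_scalar !mxE big_cons; ring.
    by rewrite -mulmxA mulmxBl -BN mul_scalar_mx mulmxBr mulmxA IHs mul0mx -scalemxAr IHs scaler0 subr0.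
  case/eqP: u0; apply/rowP => i; rewrite [RHS]mxE.
  pose s := [seq d 0 j | j <- rem i (enum 'I_n)].
  have key0 := key s.
  pose c := \prod_(c <- s) (d 0 i - c).
  have c0 : c != 0.
    rewrite /c prodf_seq_neq0; apply/allP => x /mapP [j]; rewrite mem_rem_uniq ?enum_uniq //.
    rewrite inE => /andP [ji _] ->; rewrite subr_eq0; apply: contra ji => /eqP /dinj ->.
    by rewrite eqxx.
  have single : \row_j (u 0 j * \prod_(c <- s) (d 0 j - c)) = (u 0 i * c) *: delta_mx 0 i.
    apply/rowP => j; rewrite !mxE eqxx /=; case: eqVneq => [->|ji]; first by rewrite mulr1.
    rewrite mulr0 (_ : \prod_(c <- s) _ = 0) ?mulr0 //; apply/eqP.
    rewrite prodf_seq_eq0; apply/hasP; exists (d 0 j); last by rewrite subrr eqxx.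
    by apply: map_f; rewrite mem_rem_uniq ?enum_uniq // inE ji mem_enum.
  move: key0; rewrite single -scalemxAl -rowE rowK => /eqP.
  by rewrite scaler_eq0 (negPf (vP i).1) orbF mulf_eq0 (negPf c0) orbF => /eqP.
have [G GB] : exists G, G = B *m B^T by exists (B *m B^T).
have Gd i j : i != j -> G i j = 0.
  move=> ij; have : diag_mx d *m G = G *m diag_mx d.
    rewrite GB mulmxA -BN -!mulmxA; congr (_ *m _).
    by rewrite -[diag_mx d]tr_diag_mx -trmx_mul -BN trmx_mul NT.
  move=> /matrixP/(_ i j); rewrite mul_diag_mx mul_mx_diag !mxE => /eqP.
  rewrite mulrC -subr_eq0 -mulrBr mulf_eq0 => /orP [/eqP //|].
  by rewrite subr_eq0 => /eqP /dinj ijE; rewrite ijE eqxx in ij.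
have GE : G = diag_mx (\row_i G i i).
  by apply/matrixP => i j; rewrite !mxE; case: eqVneq => [->|/Gd ->]; rewrite ?mulr1n ?mulr0n // mxE.
have G0 i : G i i != 0.
  have : \det G != 0 by rewrite -unitfE -unitmxE GB unitmx_mul unitmx_tr Bunit.
  by rewrite GE det_diag => /prodf_neq0 /(_ i isT); rewrite !mxE eqxx.
have /fin_all_exists [r rP] i := closed_sqrt (G i i).
have r0 i : r i != 0 by apply: contra (G0 i) => /eqP ri; rewrite -rP ri expr0n.
pose D := diag_mx (\row_i (r i)^-1).
have DGD : D *m G *m D = 1%:M.
  rewrite GE /D !mulmx_diag -diag_const_mx; congr diag_mx; apply/rowP => i.
  by rewrite !mxE -rP; field.
have VV : (D *m B) *m (D *m B)^T = 1%:M by rewrite trmx_mul tr_diag_mx !mulmxA -(mulmxA D B) -GB DGD.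
exists (D *m B); split=> //.
by rewrite -(mulmxA D B N) BN (mulmxA D) /D diag_mxC -(mulmxA _ _ B) -mulmxA VV mulmx1.
Qed.
End Orth.

(** * Cross products and Gram matrices *)

Section SO3.
Variable R : comPzRingType.
Implicit Types a : 'M[R]_3.

(** The cofactors along the third column form the cross product of the first two columns. *)
Definition cross_completion a : 'M[R]_3 :=
  \matrix_(i, j) if j == 2%N :> nat then \adj a j i else a i j.

Lemma cross_completionE (F : nat -> nat -> R) :
  cross_completion (\matrix_(i, j) F i j) = table 0 3 3
  [:: [:: F 0%N 0%N; F 0%N 1%N; F 1%N 0%N * F 2%N 1%N - F 2%N 0%N * F 1%N 1%N];
      [:: F 1%N 0%N; F 1%N 1%N; F 2%N 0%N * F 0%N 1%N - F 0%N 0%N * F 2%N 1%N];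
      [:: F 2%N 0%N; F 2%N 1%N; F 0%N 0%N * F 1%N 1%N - F 1%N 0%N * F 0%N 1%N]].
Proof.
by apply/matrixP; ord3; ord3; rewrite !mxE //= /cofactor det_mx2 !mxE /=; ring.
Qed.

Lemma gram_cross a (i j : 'I_3) :
  ((cross_completion a)^T *m a) i j =
  if i == 2%N :> nat then (if j == 2%N :> nat then \det a else 0) else (a^T *m a) i j.
Proof.
have [F ->] := mx_natE a; rewrite cross_completionE det3.
by move: i j; ord3; ord3; rewrite !mxsimp /=; ring.
Qed.

(** The last diagonal entry is Lagrange's identity for the squared length of a cross product. *)
Lemma gram_cross_cross a : (cross_completion a)^T *m cross_completion a =
  \matrix_(i, j) if i == 2%N :> nat
                 then (if j == 2%N :> nat then (a^T *m a) 0 0 * (a^T *m a) 1 1 - (a^T *m a) 0 1 ^+ 2 else 0)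
                 else if j == 2%N :> nat then 0 else (a^T *m a) i j.
Proof.
have [F ->] := mx_natE a; rewrite cross_completionE.
by apply/matrixP; ord3; ord3; rewrite !mxsimp /=; ring.
Qed.

Lemma det_cross_completion a : \det (cross_completion a) =
  (a^T *m a) 0 0 * (a^T *m a) 1 1 - (a^T *m a) 0 1 ^+ 2.
Proof.
have [F ->] := mx_natE a; rewrite cross_completionE det_table !mxsimp /=; ring.
Qed.
End SO3.

(** * Rotations, their lifts to SL_2, and null eigenvectors *)

Section Transitive.
Variable k : closedFieldType.
Hypothesis two_neq0 : 2%:R != 0 :> k.

Definition special_orthogonal n (P : 'M[k]_n) := P^T *m P = 1%:M /\ \det P = 1.

(* P maps the first two columns of a, and hence their cross product, to those
   of b; the third column is determined by its inner products with these. *)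
Lemma gram_transitive (a b : 'M[k]_3) : a^T *m a = b^T *m b -> \det a = \det b ->
  (a^T *m a) 0 0 * (a^T *m a) 1 1 - (a^T *m a) 0 1 ^+ 2 != 0 ->
  exists P, special_orthogonal P /\ b = P *m a.
Proof.
move=> ab dab.
have := (det_cross_completion a, det_cross_completion b).
have := (gram_cross_cross a, gram_cross_cross b).
have := (gram_cross a, gram_cross b).
rewrite dab ab.
set m := _ - _; set M := \matrix_(i, j) _.
set A := cross_completion a; set B := cross_completion b.
move=> [Aa Bb] [AA BB] [dA dB] m0.
have Aunit : A \in unitmx by rewrite unitmxE dA unitfE.
have Bunit : B^T \in unitmx by rewrite unitmxE det_tr dB unitfE.
exists (B *m invmx A); split; [split|].
- rewrite trmx_mul -mulmxA (mulmxA _ B) BB -AA -(mulmxA _ A) mulmxV // mulmx1.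
  by rewrite -trmx_mul mulmxV // trmx1.
- by rewrite det_mulmx det_inv dA dB divff.
(* Multiplied by B^T, the right side becomes A^T a, since A and B have the same Gram matrix; it
   agrees with B^T b entrywise. *)
apply: (can_inj (mulKmx Bunit)).
rewrite !mulmxA BB -AA -(mulmxA _ A) mulmxV // mulmx1.
by apply/matrixP => i j; rewrite Aa Bb.
Qed.

(** In the eigenbasis, [T] commutes with a diagonal matrix with distinct entries, so it is diagonal,
    and orthogonality makes its entries signs. Indexing by a finite type makes these matrices
    enumerable. *)
Lemma orthogonal_commutant n (N V T : 'M[k]_n) (d : 'rV_n) :
  V *m V^T = 1%:M -> V *m N *m V^T = diag_mx d -> injective (d 0) ->
  T *m T^T = 1%:M -> T *m N = N *m T ->
  exists e : {ffun 'I_n -> bool}, T = V^T *m diag_mx (\row_i (-1) ^+ e i) *m V.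
Proof.
move=> VV VNV dinj TT TN.
have VVt := mulmx1C VV.
have [W WE] : exists W, W = V *m T *m V^T by exists (V *m T *m V^T).
have TW : T = V^T *m W *m V by rewrite WE !mulmxA VVt mul1mx -mulmxA VVt mulmx1.
have Wd : W *m diag_mx d = diag_mx d *m W.
  rewrite -VNV WE !mulmxA -(mulmxA _ V^T V) VVt mulmx1 -(mulmxA _ T N) TN.
  by rewrite -(mulmxA _ V^T V) VVt mulmx1 !mulmxA.
have W0 i j : i != j -> W i j = 0.
  move=> ij; move/matrixP/(_ i j): Wd; rewrite mul_diag_mx mul_mx_diag !mxE => /eqP.
  rewrite mulrC -subr_eq0 -mulrBl mulf_eq0 => /orP [|/eqP //].
  by rewrite subr_eq0 => /eqP /dinj ijE; rewrite ijE eqxx in ij.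
have WD : W = diag_mx (\row_i W i i).
  by apply/matrixP => i j; rewrite !mxE; case: eqVneq => [->|/W0 ->]; rewrite ?mulr1n ?mulr0n // mxE.
have W1 i : W i i ^+ 2 = 1.
  have : W *m W^T = 1%:M.
    by rewrite WE !trmx_mul trmxK !mulmxA -(mulmxA _ V^T V) VVt mulmx1 -(mulmxA _ T) TT mulmx1 VV.
  rewrite WD tr_diag_mx mulmx_diag => /matrixP/(_ i i).
  by rewrite !mxE eqxx !mulr1n -expr2.
exists [ffun i => W i i == -1].
rewrite TW [in LHS]WD; congr (_ *m diag_mx _ *m _); apply/rowP => i; rewrite !mxE ffunE.
by move/eqP: (W1 i); rewrite sqrf_eq1 => /orP [] /eqP ->; rewrite ?eqxx // -subr_eq0 opprK (negPf two_neq0).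
Qed.

(** A binary quadratic form of zero discriminant is the square of p X + q U; square roots of the
    outer coefficients work up to the sign of p. *)
Lemma square_of_null (c0 c1 c2 : k) : c1 ^+ 2 = 4%:R * c0 * c2 ->
  exists p q, [/\ c0 = q ^+ 2, c1 = 2%:R * p * q & c2 = p ^+ 2].
Proof.
have [q qE] := closed_sqrt c0; have [p pE] := closed_sqrt c2.
have -> : 4%:R * c0 * c2 = (2%:R * p * q) ^+ 2 by rewrite -qE -pE; ring.
move/eqP; rewrite eqf_sqr => /orP [] /eqP c1E; first by exists p, q.
by exists (- p), q; split=> //; rewrite ?sqrrN // c1E; ring.
Qed.

Lemma gram_disc (F : nat -> nat -> k) (i j : 'I_3) :
  let T := \matrix_(i, j) F i j in
  (T^T *m discmx k *m T) i j =
  F 1%N i * F 1%N j - 2%:R * F 0%N i * F 2%N j - 2%:R * F 2%N i * F 0%N j.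
Proof. by move=> T; rewrite {}/T !mxsimp /=; ring. Qed.

(** The outer columns of [T] are null, hence squares of linear forms; their pairing forces the
    determinant of these forms to be 1 or -1, and a sign change makes it 1. After dividing by the
    resulting [sym2 g], the outer columns are standard, and orthogonality with determinant 1 fixes
    the middle one. *)
Lemma sym2_onto (T : 'M[k]_3) : T^T *m discmx k *m T = discmx k -> \det T = 1 ->
  exists g, \det g = 1 /\ sym2 g = T.
Proof.
move=> TJ dT.
have [p [q [r [s [D cT]]]]] : exists p q r s : k, p * s - q * r = 1 /\
  forall i j : 'I_3, j != 1%N :> nat -> T i j = sym2 (mx2 p q r s) i j.
  have [F TE] := mx_natE T; move: TJ; rewrite TE => TJ.
  have J i j := etrans (esym (gram_disc F i j)) (congr1 (fun M : 'M[k]_3 => M i j) TJ).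
  have := (J (inord 0) (inord 0), J (inord 2) (inord 2), J (inord 0) (inord 2)).
  rewrite !mxE !inordK //= => -[[J00 J22] J02].
  have [|r [s [F00 F10 F20]]] := @square_of_null (F 0 0)%N (F 1 0)%N (F 2 0)%N.
    by apply/eqP; rewrite -subr_eq0 -[X in _ == X]J00; apply/eqP; ring.
  have [|p [q [F02 F12 F22]]] := @square_of_null (F 0 2)%N (F 1 2)%N (F 2 2)%N.
    by apply/eqP; rewrite -subr_eq0 -[X in _ == X]J22; apply/eqP; ring.
  have : (p * s - q * r) ^+ 2 = 1.
    apply: (mulfI two_neq0); apply: oppr_inj; rewrite mulr1 -[RHS]J02 F00 F10 F20 F02 F12 F22; ring.
  move/eqP; rewrite sqrf_eq1 => /orP [] /eqP D.
    exists p, q, r, s; split=> //.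
    by ord3; ord3 => // _; rewrite !mxE //= ?F00 ?F10 ?F20 ?F02 ?F12 ?F22 //; ring.
  exists p, q, (- r), (- s); split; first by rewrite !mulrN -opprD D opprK.
  by ord3; ord3 => // _; rewrite !mxE //= ?F00 ?F10 ?F20 ?F02 ?F12 ?F22 //; ring.
pose g := mx2 p q r s; pose g' := mx2 s (- q) (- r) p.
have gg' : g' *m g = 1%:M.
  by apply/matrixP => [] [[|[|//]] ?] [[|[|//]] ?]; rewrite !mxsimp /= -?D; ring.
have dg : \det g = 1 by rewrite det_mx2_of.
have dg' : \det g' = 1 by rewrite det_mx2_of -D; ring.
exists g; split=> //.
have SS : sym2 g *m sym2 g' = 1%:M by rewrite sym2M gg' sym2_1.
suff W1 : sym2 g' *m T = 1%:M by rewrite -[LHS]mulmx1 -W1 mulmxA SS mul1mx.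
have WJ : (sym2 g' *m T)^T *m discmx k *m (sym2 g' *m T) = discmx k.
  by rewrite trmx_mul !mulmxA -(mulmxA T^T) -(mulmxA T^T) sym2_disc dg' expr1n scale1r TJ.
have dW : \det (sym2 g' *m T) = 1 by rewrite det_mulmx det_sym2 dg' expr1n mul1r.
have Wc (i j : 'I_3) : j != 1%N :> nat -> (sym2 g' *m T) i j = (i == j)%:R.
  move=> j1; have <- : (sym2 g' *m sym2 g) i j = (i == j)%:R by rewrite (mulmx1C SS) mxE.
  by rewrite !mxE; apply: eq_bigr => l _; rewrite cT.
move: (sym2 g' *m T) WJ dW Wc => W; have [F ->] := mx_natE W => WJ dW Wc.
have J i j := etrans (esym (gram_disc F i j)) (congr1 (fun M : 'M[k]_3 => M i j) WJ).
have := (J (inord 0) (inord 1), J (inord 1) (inord 2)); rewrite !mxE !inordK //= => -[J01 J12].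
have Wc' (i j : nat) : (i < 3)%N -> (j < 3)%N -> j != 1%N -> F i j = (i == j)%:R.
  move=> i3 j3 j1; have := Wc (Ordinal i3) (Ordinal j3) j1.
  by rewrite mxE.
move: dW J01 J12; rewrite det3 !(Wc' _ 0%N) // !(Wc' _ 2%N) //= => dW J01 J12.
have F1 : F 1%N 1%N = 1 by rewrite -[RHS]dW; ring.
have F0 : F 0%N 1%N = 0.
  apply: (mulfI two_neq0); apply: oppr_inj; rewrite mulr0 oppr0 -[RHS]J12; ring.
have F2 : F 2%N 1%N = 0.
  apply: (mulfI two_neq0); apply: oppr_inj; rewrite mulr0 oppr0 -[RHS]J01; ring.
by apply/matrixP; ord3; ord3; rewrite !mxE /= ?F0 ?F1 ?F2 ?Wc'.
Qed.

(* A null eigenvector of the symmetric form C a^T (C^T C) a C^T gives, up to C,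
   a point (y : v) such that the quadratic form a(-, y) is the square of a
   linear form; the zero of the latter is a singular point. *)
Lemma smooth_no_null_eigenvector (a C : 'M[k]_3) : C^T *m C = discmx k ->
  (forall x u y v, (x, u) != (0, 0) -> (y, v) != (0, 0) -> ~ singular_at a x u y v) ->
  no_null_eigenvector ((C *m a *m C^T)^T *m (C *m a *m C^T)).
Proof.
move=> CC smooth z l zN zz; apply/eqP/negPn/negP => z0.
(* The inverse of [discmx], that is, the Gram matrix of the dual form. *)
pose K : 'M[k]_3 := table 0 3 3 [:: [:: 0; 0; - 2%:R^-1]; [:: 0; 1; 0]; [:: - 2%:R^-1; 0; 0]].
have JK : discmx k *m K = 1%:M.
  by apply/matrixP; ord3; ord3; rewrite !mxsimp /=; field.
have KJ := mulmx1C JK.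
have CKC : C *m K *m C^T = 1%:M.
  by apply: mulmx1C; rewrite mulmxA CC JK.
have [q qE] : exists q, q = z *m C by exists (z *m C).
have zE : z = q *m K *m C^T by rewrite qE -!mulmxA (mulmxA C) CKC mulmx1.
have qaJaJ : q *m a^T *m discmx k *m a *m discmx k = l *: q.
  by rewrite qE -CC scalemxAl -zN !trmx_mul trmxK !mulmxA.
have qaJa : q *m a^T *m discmx k *m a = l *: (q *m K).
  by rewrite scalemxAl -qaJaJ -(mulmxA _ (discmx k) K) JK mulmx1.
have KT : K^T = K by apply/matrixP; ord3; ord3; rewrite !mxE.
have qKq : q *m K *m q^T = 0.
  by rewrite -zz {2}zE !trmx_mul trmxK KT {1}zE !mulmxA -(mulmxA _ C^T C) CC -(mulmxA _ (discmx k)) JK mulmx1.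
have q0 : q != 0.
  by apply: contra z0 => /eqP q0; rewrite zE q0 !mul0mx.
(* The equation q K q^T = 0 reads q_1^2 = q_0 q_2, so q lies on the Veronese conic. *)
have [y [v qyv]] : exists y v, q = veronese y v.
  have [F qT] := col3E q^T; have := qKq; rewrite -[q]trmxK qT => /matrixP/(_ 0 0).
  rewrite !mxsimp /= => E.
  have [|y [v [F0 F1 F2]]] := @square_of_null (F 0%N) (2%:R * F 1%N) (F 2%N).
    apply/eqP; rewrite -subr_eq0; apply/eqP.
    by transitivity (4%:R * (0 : k)); [rewrite -[X in _ = _ * X]E; field | rewrite mulr0].
  exists y, v; apply/matrixP => i; rewrite ord1 {i}; ord3; rewrite !mxE //=.
  by apply: (mulfI two_neq0); rewrite F1 mulrA.
have yv0 : (y, v) != (0, 0).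
  apply: contra q0 => /eqP [y0 v0]; rewrite qyv y0 v0.
  by apply/eqP/matrixP => i; rewrite ord1 {i}; ord3; rewrite !mxE //= ?mulr0 ?expr0n.
(* The row q a^T lists the coefficients of a(-, y); its discriminant is l q K q^T = 0, so the form
   is (r x + s u)^2, with zero (s : -r). *)
have [r [s cE]] : exists r s, q *m a^T = table 0 1 3 [:: [:: s ^+ 2; 2%:R * r * s; r ^+ 2]].
  have cJc : q *m a^T *m discmx k *m (q *m a^T)^T = 0.
    by rewrite trmx_mul trmxK mulmxA qaJa -scalemxAl qKq scaler0.
  have [F cT] := col3E (q *m a^T)^T; move: cJc; rewrite -[q *m a^T]trmxK cT => /matrixP/(_ 0 0).
  rewrite !mxsimp /= => E.
  have [|r [s [F0 F1 F2]]] := @square_of_null (F 0%N) (F 1%N) (F 2%N).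
    by apply/eqP; rewrite -subr_eq0 -[X in _ == X]E; apply/eqP; ring.
  by exists r, s; apply/matrixP => i; rewrite ord1 {i}; ord3; rewrite !mxE //=.
have cT : a *m q^T = (table 0 1 3 [:: [:: s ^+ 2; 2%:R * r * s; r ^+ 2]])^T.
  by rewrite -cE trmx_mul trmxK.
have [rs0|rs0] := eqVneq (s, - r) (0, 0).
  have aq0 : a *m q^T = 0.
    move: rs0 => [s0 /eqP]; rewrite oppr_eq0 => /eqP r0; rewrite cT s0 r0.
    by apply/matrixP; ord3; move=> j; rewrite ord1 !mxE /= ?mulr0 ?expr0n.
  (* Here a(-, y) vanishes identically, so the curve contains a line. A zero of one partial
     derivative in (y : v) along this line is singular: Euler's relation kills the other partial,
     provided [w] is chosen according to whether v = 0. *)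
  pose w := if v == 0 then veroneseU y v else veroneseX y v.
  have [F wT] := col3E (a *m w^T).
  have [x [u [xu0 xuE]]] := binary_quadratic_root two_neq0 (F 0%N) (F 1%N) (F 2%N).
  apply: (smooth x u y v) => //.
  have xw : veronese x u *m a *m w^T = 0.
    rewrite -mulmxA wT; apply/matrixP => i j; rewrite !ord1 !mxsimp /= -[RHS]xuE; ring.
  have euler : veronese x u *m a *m (y *: veroneseX y v + v *: veroneseU y v)^T = 0.
    have -> : y *: veroneseX y v + v *: veroneseU y v = 2%:R *: q.
      by rewrite qyv; apply/matrixP => i; rewrite ord1 {i}; ord3; rewrite !mxE /=; ring.
    by rewrite linearZ /= -scalemxAr -mulmxA aq0 mulmx0 scaler0.
  rewrite linearD !linearZ /= mulmxDr -!scalemxAr in euler.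
  rewrite /singular_at /fval -!(mulmxA _ a (veronese y v)^T) -qyv aq0 !mulmx0; split=> //; first by rewrite mxE.
    move: xw; rewrite /w; case: ifP => [/eqP v0|//] xw.
    move: euler; rewrite v0 scale0r addr0 => /eqP; rewrite scaler_eq0 => /orP [/eqP y0|/eqP //].
    by rewrite y0 v0 eqxx in yv0.
  move: xw; rewrite /w; case: ifP => [//|v0] xw.
  by move: euler; rewrite xw scaler0 add0r => /eqP; rewrite scaler_eq0 v0 => /eqP.
(* The discriminant form turns the square r x + s u into the Veronese vector of its zero. The result
   is proportional to q K, which annihilates the tangent vectors of the conic at q, so the partials
   in y and v vanish. *)
have xa : veronese s (- r) *m a = (- (l / 2%:R)) *: (q *m K).
  have -> : veronese s (- r) = (- 2%:R^-1) *: (q *m a^T *m discmx k).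
    by rewrite cE; apply/matrixP => i; rewrite ord1 {i}; ord3; rewrite !mxsimp /=; field.
  by rewrite -scalemxAl qaJa scalerA; congr (_ *: _); field.
apply: (smooth s (- r) y v) => //.
rewrite /singular_at /fval xa -!(mulmxA _ a (veronese y v)^T) -qyv -!scalemxAl qKq cT scaler0; split.
- by rewrite mxE.
- by apply/matrixP => i j; rewrite !ord1 !mxsimp /=; ring.
- by apply/matrixP => i j; rewrite !ord1 !mxsimp /=; ring.
- rewrite (_ : q *m K *m _ = 0) ?scaler0 // qyv.
  by apply/matrixP => i j; rewrite !ord1 !mxsimp /=; field.
rewrite (_ : q *m K *m _ = 0) ?scaler0 // qyv.
by apply/matrixP => i j; rewrite !ord1 !mxsimp /=; field.
Qed.
End Transitive.

(** * Singular curves are not stable *)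

Section Stability.
Variable k : closedFieldType.
Hypothesis two_neq0 : 2%:R != 0 :> k.
Implicit Types (a b : 'M[k]_3) (g h : 'M[k]_2) (x u y v t : k).

Lemma exists_avoiding (l : seq k) : exists2 t, t != 0 & t \notin l.
Proof.
have : \prod_(c <- 0 :: l) ('X - c%:P) != 0 by rewrite monic_neq0 // monic_prod_XsubC.
move/closed_nonrootP => [t]; rewrite root_prod_XsubC inE negb_or => /andP [t0 tl].
by exists t.
Qed.

Lemma poly_vanish0 (q : {poly k}) : (forall t, t != 0 -> q.[t] = 0) -> q.[0] = 0.
Proof.
move=> q0; have [->|qN0] := eqVneq q 0; first by rewrite horner0.
have : q * 'X != 0 by rewrite mulf_neq0 ?polyX_eq0.
move/closed_nonrootP => [t]; rewrite rootM rootX negb_or => /andP [qt t0].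
by case/negP: qt; apply/eqP/q0.
Qed.

Lemma meval_vanish0 n (P : {mpoly k[n]}) (F : 'I_n -> {poly k}) :
  (forall t, t != 0 -> P.@[fun i => (F i).[t]] = 0) -> P.@[fun i => (F i).[0]] = 0.
Proof.
pose q := \sum_(m <- msupp P) P@_m *: \prod_i F i ^+ m i.
have qE t : P.@[fun i => (F i).[t]] = q.[t].
  rewrite mevalE /q horner_sum; apply: eq_bigr => m _.
  by rewrite hornerZ horner_prod; congr (_ * _); apply: eq_bigr => i _; rewrite horner_exp.
by move=> P0; rewrite qE; apply: poly_vanish0 => t t0; rewrite -qE P0.
Qed.

(** The member at t = 0 of a polynomial family lies in the Zariski closure of the members with t
    nonzero. *)
Lemma coordfun_vanish0 (P : {mpoly k[3 * 3]}) (A : 'M[{poly k}]_3) :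
  (forall t, t != 0 -> coordfun P (map_mx (horner^~ t) A) = 0) ->
  coordfun P (map_mx (horner^~ 0) A) = 0.
Proof.
have E t : coordfun P (map_mx (horner^~ t) A) = P.@[fun i => (mxvec A 0 i).[t]].
  by apply: meval_eq => i; rewrite -map_mxvec mxE.
rewrite E => P0; apply: meval_vanish0 => t t0; by rewrite -E P0.
Qed.

(** Such a [g] sends (0 : 1) to (x : u), so substituting it moves a given point to (0 : 1). *)
Lemma complete_column x u : (x, u) != (0, 0) ->
  exists g, [/\ \det g = 1, g 0 1 = x & g 1 1 = u].
Proof.
rewrite xpair_eqE; have [u0|u0 _] := eqVneq u 0.
  rewrite andbT => x0; exists (mx2 0 x (- x^-1) u).
  by rewrite det_mx2_of !mxE /=; split=> //; field.
by exists (mx2 u^-1 x 0 u); rewrite det_mx2_of !mxE /=; split=> //; field.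
Qed.

Lemma entryE m n p q (S : 'M[k]_(m, n)) (a : 'M_(n, p)) (T : 'M_(q, p)) i j :
  (S *m a *m T^T) i j = (row i S *m a *m (row j T)^T) 0 0.
Proof.
rewrite tr_row -row_mul mxE [RHS]mxE; apply: eq_bigr => l _.
by congr (_ * _); rewrite [RHS]mxE.
Qed.

Lemma row0_sym2 g : row 0 (sym2 g) = veronese (g 0 1) (g 1 1).
Proof. by apply/matrixP => i; rewrite ord1 {i}; ord3; rewrite !mxE. Qed.

(** Together with [row0_sym2], this makes the entries 00, 10 and 01 of the transformed matrix the
    value and directional derivatives at the chosen point. *)
Lemma row1_sym2 g : row 1 (sym2 g) =
  g 0 0 *: veroneseX (g 0 1) (g 1 1) + g 1 0 *: veroneseU (g 0 1) (g 1 1).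
Proof. by apply/matrixP => i; rewrite ord1 {i}; ord3; rewrite !mxE /=; ring. Qed.

Definition torus t : 'M[k]_2 := mx2 t 0 0 t^-1.

Lemma det_torus t : t != 0 -> \det (torus t) = 1.
Proof. by move=> t0; rewrite det_mx2_of; field. Qed.

(** The monomial of index (i, j) has weight 2 (i + j - 2), written as a quotient because this may be
    negative. *)
Lemma torus_act t a i j : t != 0 ->
  (sym2 (torus t) *m a *m (sym2 (torus t))^T) i j = t ^+ (2 * i) * t ^+ (2 * j) / t ^+ 4 * a i j.
Proof.
move=> t0; have -> : sym2 (torus t) = diag_mx (\row_i (t ^+ (2 * i) / t ^+ 2)).
  by apply/matrixP; ord3; ord3; rewrite !mxE /=; field.
by rewrite tr_diag_mx mul_diag_mx mul_mx_diag !mxE; field.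
Qed.

Lemma not_stable_of_singular a x u y v : (x, u) != (0, 0) -> (y, v) != (0, 0) ->
  singular_at a x u y v -> orbit_closed a -> finite_stabilizer a -> False.
Proof.
move=> xu0 yv0 [f0 fX fU fY fV] closed [s sP].
have [g [dg gx gu]] := complete_column xu0.
have [h [dh hy hv]] := complete_column yv0.
have [a1 a1E] : exists a1, a1 = sym2 g *m a *m (sym2 h)^T by eexists.
have a100 : a1 0 0 = 0 by rewrite a1E entryE !row0_sym2 gx gu hy hv.
have a110 : a1 1 0 = 0.
  by rewrite a1E entryE row1_sym2 row0_sym2 gx gu hy hv !mulmxDl -!scalemxAl fX fU !scaler0 addr0 mxE.
have a101 : a1 0 1 = 0.
  rewrite a1E entryE row1_sym2 row0_sym2 gx gu hy hv linearD !linearZ /= mulmxDr -!scalemxAr fY fV.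
  by rewrite !scaler0 addr0 mxE.
(* The subtraction truncates for i + j < 2, harmlessly, since those entries of [a1] are zero. *)
pose A : 'M[{poly k}]_3 := \matrix_(i, j) ((a1 i j)%:P * 'X^(2 * (i + j - 2))).
have At t : t != 0 -> map_mx (horner^~ t) A = sym2 (torus t) *m a1 *m (sym2 (torus t))^T.
  move=> t0; apply/matrixP => i j; rewrite torus_act // !mxE hornerM hornerC hornerXn.
  have [ij|ij] := leqP 2 (i + j).
    rewrite mulrC; congr (_ * _); apply: (mulIf (expf_neq0 4 t0)).
    rewrite mulfVK ?expf_neq0 // -!exprD; congr (_ ^+ _).
    by rewrite -mulnDr -[4%N]/(2 * 2)%N -mulnDr subnK.
  suff -> : a1 i j = 0 by rewrite mul0r mulr0.
  move: i j ij; ord3; ord3 => //= _; [rewrite -[RHS]a100|rewrite -[RHS]a101|rewrite -[RHS]a110];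
    by congr (a1 _ _); apply: val_inj.
pose a0 := map_mx (horner^~ 0) A.
have : Defs.in_orbit a a0.
  apply: closed => P P0; apply: coordfun_vanish0 => t t0; apply: P0.
  rewrite At //; apply/in_orbitP; exists (g *m torus t), (h *m torus t).
  by rewrite !det_mulmx dg dh det_torus // mulr1 -!sym2M trmx_mul a1E !mulmxA.
move=> /in_orbitP [g2 [h2 [dg2 dh2 a0E]]].
(* Only the entries of weight zero, i + j = 2, survive in the limit. *)
have a0_torus t : t != 0 -> sym2 (torus t) *m a0 *m (sym2 (torus t))^T = a0.
  move=> t0; apply/matrixP => i j; rewrite torus_act // !mxE hornerM hornerC hornerXn.
  case: (eqVneq (i + j)%N 2%N) => [ij|].
    by rewrite -exprD -mulnDr ij divff ?expf_neq0 // mul1r.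
  move=> ij; have [ij2|ij2] := leqP 2 (i + j).
    by rewrite expr0n muln_eq0 /= subn_eq0 leqNgt ltn_neqAle eq_sym ij ij2 /= !mulr0.
  suff -> : a1 i j = 0 by rewrite mul0r mulr0.
  move: i j ij2 {ij}; ord3; ord3 => //= _; [rewrite -[RHS]a100|rewrite -[RHS]a101|rewrite -[RHS]a110];
    by congr (a1 _ _); apply: val_inj.
have g2u : g2 \in unitmx by rewrite unitmxE dg2 unitr1.
have h2u : h2 \in unitmx by rewrite unitmxE dh2 unitr1.
(* [g2] and [h2] conjugate the torus into the stabilizer of [a], and undoing the conjugation
   recovers [t] as a corner entry; a [t] outside the finite list is a contradiction. *)
have [t t0 /negP tl] := exists_avoiding [seq (invmx g2 *m p.1 *m g2) 0 0 | p <- s].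
apply: tl; apply/mapP; exists (g2 *m torus t *m invmx g2, h2 *m torus t *m invmx h2); last first.
  by rewrite /= !mulmxA mulVmx // mul1mx mulmxKV // mxE.
apply: sP.
- by rewrite !det_mulmx det_torus // det_inv dg2 !mul1r invr1.
- by rewrite !det_mulmx det_torus // det_inv dh2 !mul1r invr1.
rewrite act_biform; congr biform.
have K (l : 'M[k]_2) : l \in unitmx -> sym2 (invmx l) *m sym2 l = 1%:M.
  by move=> lu; rewrite sym2M mulmxV // sym2_1.
have aE : a = sym2 (invmx g2) *m a0 *m (sym2 (invmx h2))^T.
  rewrite a0E !mulmxA K // mul1mx -mulmxA -trmx_mul K // trmx1 mulmx1 //.
rewrite -!sym2M !trmx_mul [RHS]aE -(a0_torus t t0) a0E !mulmxA.
by rewrite -!mulmxA.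
Qed.
End Stability.

(** * Smooth curves are stable *)

Section SmoothStable.
Variable k : closedFieldType.
Hypothesis two_neq0 : 2%:R != 0 :> k.
Implicit Types (a b : 'M[k]_3) (g h : 'M[k]_2) (x u y v t l : k).

Lemma discmx_factor : exists C : 'M[k]_3, C^T *m C = discmx k.
Proof.
have [I I2] := closed_sqrt (-1 : k).
(* This is c1^2 - 4 c0 c2 = c1^2 + (I (c0 + c2))^2 + (c0 - c2)^2. *)
exists (table 0 3 3 [:: [:: 0; 1; 0]; [:: I; 0; I]; [:: 1; 0; -1]]).
by apply/matrixP; ord3; ord3; rewrite !mxsimp /=; ring: I2.
Qed.

Lemma det_discmx_neq0 : \det (discmx k) != 0.
Proof.
rewrite (_ : \det _ = - (2%:R ^+ 2)); first by rewrite oppr_eq0 expf_neq0.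
by rewrite det_table /=; ring.
Qed.

Variable C : 'M[k]_3.
Hypothesis CC : C^T *m C = discmx k.

(* Locked, lest rewriting modulo associativity look inside. *)
Definition gram a := locked ((C *m a *m C^T)^T *m (C *m a *m C^T)).
Definition so3 g : 'M[k]_3 := locked (C *m sym2 g *m invmx C).

Lemma gramE a : gram a = (C *m a *m C^T)^T *m (C *m a *m C^T).
Proof. by rewrite /gram -lock. Qed.

Lemma so3E g : so3 g = C *m sym2 g *m invmx C.
Proof. by rewrite /so3 -lock. Qed.

Let Cunit : C \in unitmx.
Proof.
rewrite unitmxE unitfE; apply: contra det_discmx_neq0 => /eqP C0.
by rewrite -CC det_mulmx C0 mulr0.
Qed.

Let Ctunit : C^T \in unitmx. Proof. by rewrite unitmx_tr. Qed.

Lemma gram_sym a : (gram a)^T = gram a.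
Proof. by rewrite gramE trmx_mul trmxK. Qed.

Lemma so3C g : so3 g *m C = C *m sym2 g.
Proof. by rewrite so3E mulmxKV. Qed.

Lemma so3_orthogonal g : \det g = 1 -> (so3 g)^T *m so3 g = 1%:M.
Proof.
move=> dg; apply: (can_inj (mulKmx Ctunit)); apply: (can_inj (mulmxK Cunit)).
rewrite mulmx1 CC -[RHS]scale1r -(expr1n k 2) -dg -sym2_disc -CC.
have -> : C^T *m ((so3 g)^T *m so3 g) *m C = (so3 g *m C)^T *m (so3 g *m C).
  by rewrite trmx_mul !mulmxA.
by rewrite so3C trmx_mul !mulmxA.
Qed.

Lemma so3_onto P : P^T *m P = 1%:M -> \det P = 1 -> exists g, \det g = 1 /\ so3 g = P.
Proof.
move=> PP dP; have [||g [dg gE]] := @sym2_onto k two_neq0 (invmx C *m P *m C).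
- rewrite -CC !trmx_mul trmx_inv !mulmxA -(mulmxA _ C (invmx C)) mulmxV // mulmx1.
  by rewrite -(mulmxA _ (invmx C^T)) mulVmx // mulmx1 -(mulmxA _ P^T) PP mulmx1.
- by rewrite !det_mulmx dP mulr1 det_inv mulVf // -unitfE -unitmxE.
by exists g; rewrite so3E gE !mulmxA mulmxV // mul1mx mulmxK.
Qed.

Lemma so3_act a g h :
  C *m (sym2 g *m a *m (sym2 h)^T) *m C^T = so3 g *m (C *m a *m C^T) *m (so3 h)^T.
Proof.
rewrite -!mulmxA -trmx_mul -so3C trmx_mul !mulmxA -so3C.
by rewrite -!mulmxA.
Qed.

(** Orthogonality cancels [so3 g], leaving a conjugation by [so3 h]; hence the spectrum of [gram] is
    constant on orbits. *)
Lemma gram_act a g h : \det g = 1 ->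
  gram (sym2 g *m a *m (sym2 h)^T) = so3 h *m gram a *m (so3 h)^T.
Proof.
move=> dg; rewrite !gramE so3_act !(trmx_mul _ (so3 h)^T) trmxK trmx_mul !mulmxA.
by rewrite -(mulmxA _ (so3 g)^T) so3_orthogonal // mulmx1.
Qed.

Lemma smooth_curveP a : smooth_curve a <->
  forall x u y v, (x, u) != (0, 0) -> (y, v) != (0, 0) -> ~ singular_at a x u y v.
Proof.
by split=> smooth x u y v xu yv sing; apply: (smooth x u y v xu yv); apply/singular_atP.
Qed.

(** Transposition swaps the two projective lines, so a bound on [h] in the stabilizer also bounds
    [g]. *)
Lemma smooth_curve_tr a : smooth_curve a -> smooth_curve a^T.
Proof.
move/smooth_curveP=> smooth; apply/smooth_curveP => x u y v xu yv [f fX fU fY fV].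
have tr (p q : 'rV[k]_3) : p *m a *m q^T = (q *m a^T *m p^T)^T by rewrite !trmx_mul !trmxK mulmxA.
apply: (smooth y v x u yv xu); rewrite /singular_at /fval !tr fX fU fY fV !trmx0; split=> //.
by rewrite mxE.
Qed.

Lemma smooth_eigenbasis a : smooth_curve a -> exists (V : 'M[k]_3) d,
  [/\ V *m V^T = 1%:M, V *m gram a *m V^T = diag_mx d & injective (d 0)].
Proof.
move/smooth_curveP => smooth.
have Nnull := smooth_no_null_eigenvector two_neq0 CC smooth; rewrite -gramE in Nnull.
have [V [d [VV VNV]]] := orthogonal_diagonalization two_neq0 (gram_sym a) Nnull.
by exists V, d; split=> //; apply: distinct_eigenvalues Nnull VV VNV.
Qed.

(** [so3 h] commutes with [gram a], so [sym2 h] is one of finitely many [T e]; its corner entries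
    are the squares of the entries of [h]. *)
Lemma stabilizer_finite_right a : smooth_curve a -> exists s : seq 'M[k]_2,
  forall g h, \det g = 1 -> \det h = 1 -> sym2 g *m a *m (sym2 h)^T = a -> h \in s.
Proof.
move=> /smooth_eigenbasis [V [d [VV VNV dinj]]].
pose T (e : {ffun 'I_3 -> bool}) := invmx C *m (V^T *m diag_mx (\row_i (-1) ^+ e i) *m V) *m C.
have /fin_all_exists [r rP] (e : {ffun 'I_3 -> bool} * ('I_3 * 'I_3)) := closed_sqrt (T e.1 e.2.1 e.2.2).
pose E := [seq r e | e <- enum {: {ffun 'I_3 -> bool} * ('I_3 * 'I_3)}] ++
          [seq - r e | e <- enum {: {ffun 'I_3 -> bool} * ('I_3 * 'I_3)}].
have ET e i j x : x ^+ 2 = T e i j -> x \in E.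
  rewrite -(rP (e, (i, j))) => /eqP; rewrite eqf_sqr mem_cat => /orP [] /eqP ->; apply/orP; [left|right];
    by apply: map_f; rewrite mem_enum.
exists [seq mx2 p.1.1 p.1.2 p.2.1 p.2.2 | p <- [seq (p, q) | p <- [seq (x, y) | x <- E, y <- E],
   q <- [seq (x, y) | x <- E, y <- E]]].
move=> g h dg dh ga.
have hh := mulmx1C (so3_orthogonal dh).
have com : so3 h *m gram a = gram a *m so3 h.
  by rewrite -{2}ga gram_act // -mulmxA so3_orthogonal // mulmx1.
have [e hE] := orthogonal_commutant two_neq0 VV VNV dinj hh com.
have TE : sym2 h = T e by rewrite /T -hE so3E !mulmxA mulVmx // mul1mx mulmxKV.
apply/mapP; exists ((h 0 0, h 0 1), (h 1 0, h 1 1)); last exact: mx2_eta.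
by do 2![apply: allpairs_f];
  [apply: (ET e (inord 2) (inord 2)) | apply: (ET e (inord 0) (inord 2))
  | apply: (ET e (inord 2) (inord 0)) | apply: (ET e (inord 0) (inord 0))];
  rewrite -TE mxE !inordK.
Qed.

Lemma smooth_finite_stabilizer a : smooth_curve a -> finite_stabilizer a.
Proof.
move=> smooth.
have [sh shP] := stabilizer_finite_right smooth.
have [sg sgP] := stabilizer_finite_right (smooth_curve_tr smooth).
exists [seq (g, h) | g <- sg, h <- sh] => g h dg dh.
rewrite act_biform => /biform_inj ga; apply: allpairs_f; last exact: shP ga.
by apply: (sgP h g) => //; rewrite -{2}ga !trmx_mul trmxK mulmxA.
Qed.

(** The matrix of indeterminates turns polynomial expressions in [b] into coordinate functions. *)
Lemma generic_matrix : exists X : 'M[{mpoly k[3 * 3]}]_3,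
  forall b, map_mx (meval (mxvec b 0)) X = b.
Proof.
exists (vec_mx (\row_i 'X_i)) => b.
rewrite map_vec_mx -[RHS]mxvecK; congr vec_mx.
by apply/rowP => i; rewrite !mxE mevalXU.
Qed.

Lemma map_det_gram (R S : comPzRingType) (f : {rmorphism R -> S}) (D X : 'M[R]_3) (l : R) :
  f (\det (l%:M - (D *m X *m D^T)^T *m (D *m X *m D^T))) =
  \det ((f l)%:M - (map_mx f D *m map_mx f X *m (map_mx f D)^T)^T
                     *m (map_mx f D *m map_mx f X *m (map_mx f D)^T)).
Proof.
by rewrite -det_map_mx map_mxB map_scalar_mx map_mxM -map_trmx !map_mxM -map_trmx.
Qed.

Lemma det_gram_coordfun l : exists P : {mpoly k[3 * 3]},
  forall b, coordfun P b = \det (l%:M - gram b).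
Proof.
have [X XE] := generic_matrix.
pose D := map_mx (@mpolyC (3 * 3) k) C.
exists (\det (l%:MP%:M - (D *m X *m D^T)^T *m (D *m X *m D^T))) => b.
rewrite /coordfun (map_det_gram (meval (mxvec b 0))) XE /= mevalC gramE.
have -> // : map_mx (meval (mxvec b 0)) D = C.
by apply/matrixP => i j; rewrite 2!mxE mevalC.
Qed.

Lemma det_coordfun (c : k) : exists P : {mpoly k[3 * 3]},
  forall b, coordfun P b = \det b - c.
Proof.
have [X XE] := generic_matrix; exists (\det X - c%:MP) => b.
by rewrite /coordfun mevalB mevalC -(det_map_mx (meval (mxvec b 0))) XE.
Qed.

(* At most one of the three distinct eigenvalues vanishes. *)
Lemma reorder_eigenvalues (d : 'rV[k]_3) : injective (d 0) ->
  exists s : 'S_3, d 0 (s 0) != 0 /\ d 0 (s 1) != 0.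
Proof.
move=> dinj.
have d0 i j : i != j -> d 0 i = 0 -> d 0 j != 0.
  by move=> ij di; apply: contra ij => /eqP dj; apply/eqP/dinj; rewrite di dj.
have [d00|d00] := eqVneq (d 0 0) 0.
  by exists (tperm 0 (inord 2)); rewrite tpermL tpermD ?(d0 0) // -val_eqE /= inordK.
have [d01|d01] := eqVneq (d 0 1) 0.
  by exists (tperm 1 (inord 2)); rewrite tpermL tpermD ?(d0 1) // -val_eqE /= inordK.
by exists 1%g; rewrite !perm1.
Qed.

(** In eigenframes V and W of equal determinant, a' V^T and b' W^T share Gram matrix and
    determinant, so a rotation P on the left relates them. Then b' = P a' (W^T V)^T, and both
    rotations lift to SL_2. The reordering makes the minor in [gram_transitive], a product of two
    eigenvalues, nonzero. *)
Lemma same_invariants_same_orbit a b (d : 'rV[k]_3) : injective (d 0) ->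
  (forall i, \det ((d 0 i)%:M - gram a) = 0) -> (forall i, \det ((d 0 i)%:M - gram b) = 0) ->
  \det a = \det b -> Defs.in_orbit a b.
Proof.
move=> dinj da db dab.
have [s [ds0 ds1]] := reorder_eigenvalues dinj.
pose d' := \row_i d 0 (s i).
have d'inj : injective (d' 0) by move=> i j; rewrite !mxE => /dinj /perm_inj.
have [|V [VV VN]] := orthonormal_eigenbasis (gram_sym a) d'inj; first by move=> i; rewrite mxE.
have [W [WW WN dWV]] : exists W, [/\ W *m W^T = 1%:M, W *m gram b *m W^T = diag_mx d' & \det W = \det V].
  have [|W [WW WN]] := orthonormal_eigenbasis (gram_sym b) d'inj; first by move=> i; rewrite mxE.
  have : \det W ^+ 2 = \det V ^+ 2.
    by rewrite !expr2 -{2}(det_tr W) -{2}(det_tr V) -!det_mulmx VV WW.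
  move/eqP; rewrite eqf_sqr => /orP [] /eqP dW; first by exists W.
  (* In odd size, negating W flips its determinant and keeps the diagonalization. *)
  exists (- W); rewrite linearN /= !mulNmx !mulmxN !opprK; split=> //.
  by rewrite -scaleN1r detZ dW -signr_odd /= expr1 mulN1r opprK.

have gramV M U : (C *m M *m C^T *m U^T)^T *m (C *m M *m C^T *m U^T) = U *m gram M *m U^T.
  by rewrite trmx_mul trmxK gramE !mulmxA.
have [|||P [[PP dP] bE]] := @gram_transitive k (C *m a *m C^T *m V^T) (C *m b *m C^T *m W^T).
- by rewrite !gramV VN WN.
- by rewrite !det_mulmx !det_tr dab dWV.
- by rewrite gramV VN !mxE /= mulr0n expr0n subr0 !mulr1n mulf_neq0.
have QQ : (W^T *m V)^T *m (W^T *m V) = 1%:M.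
  by rewrite trmx_mul trmxK !mulmxA -(mulmxA _ W) WW mulmx1 (mulmx1C VV).
have dQ : \det (W^T *m V) = 1.
  by rewrite det_mulmx det_tr dWV -{1}det_tr -det_mulmx (mulmx1C VV) det1.
have [g [dg gE]] := so3_onto PP dP; have [h [dh hE]] := so3_onto QQ dQ.
apply/in_orbitP; exists g, h; split=> //.
apply: (can_inj (mulKmx Cunit)); apply: (can_inj (mulmxK Ctunit)).
rewrite so3_act gE hE trmx_mul trmxK !mulmxA in bE *.
by rewrite -[LHS]mulmx1 -(mulmx1C WW) mulmxA bE.
Qed.

Lemma smooth_orbit_closed a : smooth_curve a -> orbit_closed a.
Proof.
move=> smooth b bcl.
have [V [d [VV VNV dinj]]] := smooth_eigenbasis smooth.
have da i := eigenvalue_diag i VV VNV.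
apply: (same_invariants_same_orbit dinj da) => [i|].
  have [P PE] := det_gram_coordfun (d 0 i).
  rewrite -PE; apply: bcl => b' /in_orbitP [g [h [dg dh ->]]].
  rewrite PE gram_act //.
  have hh := mulmx1C (so3_orthogonal dh).
  have -> : (d 0 i)%:M - so3 h *m gram a *m (so3 h)^T = so3 h *m ((d 0 i)%:M - gram a) *m (so3 h)^T.
    by rewrite mulmxBr mulmxBl mul_mx_scalar -scalemxAl hh scalemx1.
  by rewrite !det_mulmx da mulr0 mul0r.
(* The determinant is constant on the orbit, as [sym2] maps SL_2 to matrices of determinant 1. *)
have [P PE] := det_coordfun (\det a).
apply/eqP; rewrite eq_sym -subr_eq0 -PE; apply/eqP/bcl => b' /in_orbitP [g [h [dg dh ->]]].
by rewrite PE !det_mulmx det_tr !det_sym2 dg dh !expr1n mul1r mulr1 subrr.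
Qed.
End SmoothStable.

Theorem mainTheorem8 (k : closedFieldType) (char0 : [pchar k] =i pred0)
  (a : 'M[k]_3) :
  git_stable a <-> smooth_curve a.
Proof.
have two_neq0 : 2%:R != 0 :> k.
  by have := char0 2%N; rewrite !inE /= => ->.
split=> [[_ [closed fin]]|smooth].
  apply/smooth_curveP => x u y v xu yv sing.
  exact: not_stable_of_singular xu yv sing closed fin.
have [C CC] := discmx_factor k.
split; last split.
- apply/eqP => a0; move/smooth_curveP: smooth => /(_ 1 0 1 0).
  rewrite a0 xpair_eqE oner_eq0 => /(_ isT isT); apply.
  by rewrite /singular_at /fval !mulmx0 !mul0mx mxE.
- exact (smooth_orbit_closed two_neq0 CC smooth).
- exact (smooth_finite_stabilizer two_neq0 CC smooth).
Qed.
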